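(* For every connected graph $G$ with independence number $\alpha(G)$, $\varphi(G)\leq \hat{\varphi}(G)+\alpha(G)-1$.
   Context: All graphs are finite, simple and undirected, with at least one vertex. $\chi$ denotes the chromatic number. For a proper vertex coloring $c$ of $G$ and an induced subgraph $H$ of $G$, let $c(H)$ be the set of colors used by $c$ on the vertices of $H$. Define $\varphi_c(G)=\max_{H}\,(|c(H)|-\chi(H))$ over all induced subgraphs $H$ of $G$, and $\hat{\varphi}_c(G)$ as the same maximum taken only over all connected induced subgraphs $H$ of $G$. Define $\varphi(G)=\min_c \varphi_c(G)$ and $\hat{\varphi}(G)=\min_c \hat{\varphi}_c(G)$, the minima over all proper colorings $c$ of $G$ (with any number of colors). *)

(* Defs.v *)
From mathcomp Require Import all_boot.
From mathcomp Require Import boolp.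

Set Implicit Arguments.
Unset Strict Implicit.
Unset Printing Implicit Defensive.

Record sgraph := SGraph {
  vertex :> finType;
  edge : rel vertex;
  edge_sym : symmetric edge;
  edge_irr : irreflexive edge
}.

Definition connected (G : sgraph) : bool :=
  [forall x : G, forall y : G, connect (@edge G) x y].

Definition independent (G : sgraph) (S : {set G}) : bool :=
  [forall x in S, forall y in S, ~~ edge x y].

Definition alpha (G : sgraph) : nat :=
  \max_(S : {set G} | independent S) #|S|.

Section Induced.
Variables (G : sgraph) (H : {set G}).

Definition induced_edge : rel {x : G | x \in H} :=
  fun x y => edge (val x) (val y).

Fact induced_edge_sym : symmetric induced_edge.
Proof. by move=> x y; apply: edge_sym. Qed.

Fact induced_edge_irr : irreflexive induced_edge.
Proof. by move=> x; apply: edge_irr. Qed.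

Definition induced : sgraph := SGraph induced_edge_sym induced_edge_irr.

End Induced.

Definition proper_coloring (G : sgraph) (C : eqType) (c : G -> C) : bool :=
  [forall x : G, forall y : G, edge x y ==> (c x != c y)].

Definition colorable (G : sgraph) (k : nat) : bool :=
  [exists c : {ffun G -> 'I_k}, proper_coloring c].

Lemma inj_proper_coloring (G : sgraph) (C : eqType) (c : G -> C) :
  injective c -> proper_coloring c.
Proof.
move=> c_inj; apply/forallP=> x; apply/forallP=> y; apply/implyP.
by apply: contraTneq => /c_inj ->; rewrite edge_irr.
Qed.

Lemma ex_colorable (G : sgraph) : exists k, colorable G k.
Proof.
exists #|G|; apply/existsP; exists (finfun (@enum_rank G)).
by apply: inj_proper_coloring => x y; rewrite !ffunE => /enum_rank_inj.
Qed.

Definition chi (G : sgraph) : nat := ex_minn (ex_colorable G).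

Definition colors (G : sgraph) (C : eqType) (c : G -> C) (H : {set G}) : seq C :=
  undup [seq c x | x in H].

(* For proper c, the difference |c(H)| - chi(H) is never truncated. *)
Lemma chi_le_colors (G : sgraph) (C : eqType) (c : G -> C) (H : {set G}) :
  proper_coloring c -> chi (induced H) <= size (colors c H).
Proof.
move=> c_proper; rewrite /chi; case: ex_minnP => k _; apply.
have idx_lt (x : induced H) : index (c (val x)) (colors c H) < size (colors c H).
  by rewrite index_mem mem_undup; apply: image_f; apply: (valP x).
apply/existsP; exists [ffun x => Ordinal (idx_lt x)].
apply/forallP=> x; apply/forallP=> y; apply/implyP=> xy; rewrite !ffunE.
move/forallP/(_ (val x))/forallP/(_ (val y))/implyP/(_ xy): c_proper.
apply: contraNneq => /(congr1 val) /= eq_idx.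
have nthK (z : induced H) :
    nth (c (val x)) (colors c H) (index (c (val z)) (colors c H)) = c (val z).
  by rewrite nth_index // -index_mem.
by rewrite -(nthK x) eq_idx nthK.
Qed.

(* Induced subgraphs are nonempty, as every graph has at least one vertex. *)
Definition phi_of (G : sgraph) (C : eqType) (c : G -> C) : nat :=
  \max_(H : {set G} | H != set0) (size (colors c H) - chi (induced H)).

Definition phihat_of (G : sgraph) (C : eqType) (c : G -> C) : nat :=
  \max_(H : {set G} | (H != set0) && connected (induced H))
    (size (colors c H) - chi (induced H)).

Lemma ex_proper_value (G : sgraph) (f : (G -> nat) -> nat) :
  exists k, `[< exists2 c : G -> nat, proper_coloring c & f c = k >].
Proof.
pose c (x : G) : nat := enum_rank x.
exists (f c); apply/asboolP; exists c => //.
by apply: inj_proper_coloring => x y /val_inj/enum_rank_inj.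
Qed.

(* The minimum of f over all proper colorings. The graph being finite, taking
   the colors in nat puts no bound on the number of colors. *)
Definition min_coloring (G : sgraph) (f : (G -> nat) -> nat) : nat :=
  ex_minn (ex_proper_value f).

Definition phi (G : sgraph) : nat := min_coloring (@phi_of G nat).

Definition phihat (G : sgraph) : nat := min_coloring (@phihat_of G nat).

(* Main.v *)
(** Given an optimal coloring for the connected parameter, every nonempty H is
    enlarged to a connected K with chi(K) <= chi(H) + alpha(G) - 1; as
    enlarging keeps all colors, this bounds |c(H)| - chi(H).  First make H
    dominating by adding vertices without neighbors in H, which does not change
    chi.  In a connected graph a component U of a dominating H can then be joined
    to the rest W of H through one new vertex a, or through an edge ab with a
    adjacent to U only and b adjacent to W only.  Either way one additional
    color is enough, and the number of components, at most alpha(G) initially,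
    drops. *)
Require Import Defs.
From mathcomp Require Import all_boot.
From mathcomp Require Import boolp zify.

Set Implicit Arguments.
Unset Strict Implicit.
Unset Printing Implicit Defensive.

(** * Connectivity inside a vertex set *)

(** Living on [G] itself, walks inside different sets can be compared and concatenated without
    passing between subtypes. *)
Definition edge_in (G : sgraph) (H : {set G}) : rel G :=
  fun x y => [&& x \in H, y \in H & edge x y].

Definition dominating (G : sgraph) (H : {set G}) : Prop :=
  forall a, a \notin H -> exists2 u, u \in H & edge a u.

(** [T] meets every component of [H], so [#|T|] bounds the number of components and stands in for it
    as the induction measure. *)
Definition covers (G : sgraph) (T H : {set G}) : Prop :=
  forall x, x \in H -> exists2 t, t \in T & connect (edge_in H) x t.

Lemma edge_in_connect_sym (G : sgraph) (H : {set G}) :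
  connect_sym (edge_in H).
Proof.
by apply: sym_connect_sym => x y; rewrite /edge_in edge_sym andbCA.
Qed.

Lemma connect_edge_inS (G : sgraph) (H K : {set G}) (x y : G) :
  H \subset K -> connect (edge_in H) x y -> connect (edge_in K) x y.
Proof.
move=> /subsetP HK; apply: connect_sub => u v /and3P[uH vH uv].
by apply: connect1; rewrite /edge_in !HK.
Qed.

Lemma connect_edge_in_mem (G : sgraph) (H : {set G}) (x y : G) :
  x \in H -> connect (edge_in H) x y -> y \in H.
Proof.
move=> xH /connectP[p xp ->]; elim: p x xH xp => //= z p IHp x xH.
by case/andP=> /and3P[_ zH _]; apply: IHp.
Qed.

Lemma connected_induced (G : sgraph) (H : {set G}) :
  {in H &, forall x y, connect (edge_in H) x y} -> connected (induced H).
Proof.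
move=> conn; apply/forallP=> x; apply/forallP=> y.
have /connectP[p] := conn _ _ (valP x) (valP y).
elim: p x => [|z p IHp] x /= => [_ /val_inj ->|]; first exact: connect0.
case/andP=> /and3P[_ zH xz] zp y_last.
exact: connect_trans (@connect1 _ _ x (Sub z zH) xz) (IHp (Sub z zH) zp y_last).
Qed.

(** * Chromatic number under adding vertices *)

(** Colorings become total functions to [nat], which can be recolored pointwise as [H] grows. *)
Lemma chi_leP (G : sgraph) (H : {set G}) (k : nat) :
  chi (induced H) <= k <->
  exists2 f : G -> nat, {in H, forall x, f x < k}
    & {in H &, forall x y, edge x y -> f x != f y}.
Proof.
rewrite /chi; case: ex_minnP => m /existsP[c c_proper] m_min; split=> [le_mk|].
- pose f x := if insub x is Some u then nat_of_ord (c u) else 0.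
  exists f => [x xH|x y xH yH xy]; rewrite /f !insubT.
    exact: leq_trans (ltn_ord _) le_mk.
  by move/forallP/(_ (Sub x xH))/forallP/(_ (Sub y yH))/implyP/(_ xy): c_proper.
- case=> f f_lt f_proper; apply: m_min; apply/existsP.
  exists [ffun x => Ordinal (f_lt _ (valP x))].
  apply/forallP=> x; apply/forallP=> y; apply/implyP=> xy; rewrite !ffunE.
  exact: f_proper (valP x) (valP y) xy.
Qed.

Lemma chi_gt0 (G : sgraph) (H : {set G}) : H != set0 -> 0 < chi (induced H).
Proof.
case/set0Pn=> x xH; have /chi_leP[f f_lt _] := leqnn (chi (induced H)).
exact: leq_ltn_trans (leq0n _) (f_lt x xH).
Qed.

Lemma chi_setU1 (G : sgraph) (H : {set G}) (a : G) :
  chi (induced (a |: H)) <= (chi (induced H)).+1.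
Proof.
have /chi_leP[f f_lt f_proper] := leqnn (chi (induced H)).
have eqHa x : x \in a |: H -> x != a -> x \in H by move=> /setU1P[->|//] /eqP.
apply/chi_leP; exists (fun x => if x == a then chi (induced H) else f x).
  by move=> x /eqHa xH; case: eqVneq xH => // _ /(_ isT)/f_lt/ltnW.
move=> x y /eqHa xH /eqHa yH.
case: (eqVneq x a) xH => [->|_ /(_ isT) xH];
  case: (eqVneq y a) yH => [->|_ /(_ isT) yH]; rewrite ?edge_irr //.
- by move=> _; rewrite neq_ltn (f_lt y yH) orbT.
- by move=> _; rewrite neq_ltn (f_lt x xH).
- exact: f_proper.
Qed.

(** The vertex [a] reuses color 0, which is among the allowed colors because [H] is nonempty. *)
Lemma chi_setU1_isolated (G : sgraph) (H : {set G}) (a : G) :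
  H != set0 -> {in H, forall u, ~~ edge a u} ->
  chi (induced (a |: H)) <= chi (induced H).
Proof.
move=> H0 aH; have /chi_leP[f f_lt f_proper] := leqnn (chi (induced H)).
have eqHa x : x \in a |: H -> x != a -> x \in H by move=> /setU1P[->|//] /eqP.
apply/chi_leP; exists (fun x => if x == a then 0 else f x).
  move=> x /eqHa xH; case: eqVneq xH => [_ _|_ /(_ isT)/f_lt //].
  exact: chi_gt0.
move=> x y /eqHa xH /eqHa yH.
case: (eqVneq x a) xH => [->|_ /(_ isT) xH];
  case: (eqVneq y a) yH => [->|_ /(_ isT) yH]; rewrite ?edge_irr //.
- by rewrite (negPf (aH y yH)).
- by rewrite edge_sym (negPf (aH x xH)).
- exact: f_proper.
Qed.

(* Shift the colors on H :\: U up by one, which frees color 0 for b there,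
   and give a the new color. *)
Lemma chi_setU2 (G : sgraph) (H U : {set G}) (a b : G) :
  H != set0 -> a \notin H -> b \notin H ->
  {in H :&: U & H :\: U, forall u w, ~~ edge u w} ->
  {in H :\: U, forall w, ~~ edge a w} ->
  {in H :&: U, forall u, ~~ edge b u} ->
  chi (induced (a |: (b |: H))) <= (chi (induced H)).+1.
Proof.
move=> H0 aH bH UW aW bU; have chi0 := chi_gt0 H0.
have /chi_leP[f f_lt f_proper] := leqnn (chi (induced H)).
pose g x := if x == a then chi (induced H) else if x == b then 0 else
  if x \in U then f x else (f x).+1.
have gH x : x \in H -> g x = if x \in U then f x else (f x).+1.
  move=> xH; rewrite /g; case: eqVneq xH aH => [->->//|_ xH _].
  by case: eqVneq xH bH => [->->|].
have ga : g a = chi (induced H) by rewrite /g eqxx.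
have gb : b != a -> g b = 0 by rewrite /g eqxx => /negPf->.
have g_lt x : x \in H -> x \in U -> g x < chi (induced H).
  by move=> xH xU; rewrite gH // xU f_lt.
have g_gt0 x : x \in H -> x \notin U -> 0 < g x.
  by move=> xH xU; rewrite gH // (negPf xU).
(* The shift may produce the color of [a] on [H :\: U], but [a] has no neighbors there. *)
have g_neqa y : y \in a |: (b |: H) -> edge a y -> g a != g y.
  rewrite ga => /setU1P[->|]; first by rewrite edge_irr.
  case/setU1P=> [->|yH] ay.
    have ba : b != a by apply: contraTneq ay => ->; rewrite edge_irr.
    by rewrite gb // neq_ltn chi0 orbT.
  have [yU|yU] := boolP (y \in U); first by have := g_lt y yH yU; lia.
  by have := aW y; rewrite !inE yH yU ay => /(_ isT).
have g_neqb y : y \in b |: H -> edge b y -> g b != g y.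
  move=> yK; have [->|/gb ->] := eqVneq b a; first by apply/g_neqa/setU1r.
  case/setU1P: yK => [->|yH by_]; first by rewrite edge_irr.
  have [yU|yU] := boolP (y \in U); last by have := g_gt0 y yH yU; lia.
  by have := bU y; rewrite !inE yH yU by_ => /(_ isT).
apply/chi_leP; exists g.
  move=> x /setU1P[->|/setU1P[->|xH]]; first by rewrite ga.
    by have [->|/gb ->] := eqVneq b a; rewrite ?ga.
  by rewrite gH //; have := f_lt x xH; case: ifP; lia.
move=> x y xK yK xy.
case/setU1P: (xK) (xy) => [-> //|xK' _]; first exact: g_neqa.
case/setU1P: (yK) (xy) => [->|yK' _].
  by rewrite edge_sym eq_sym; apply: g_neqa.
case/setU1P: (xK') (xy) => [-> //|xH _]; first exact: g_neqb.
case/setU1P: (yK') (xy) => [->|yH _].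
  by rewrite edge_sym eq_sym; apply: g_neqb.
(* On either side of [U] the recoloring is injective in [f]; no edge of [H] joins the two sides. *)
apply/eqP=> gxy; have := f_proper x y xH yH xy; move: gxy; rewrite !gH //.
case: (boolP (x \in U)) => xU; case: (boolP (y \in U)) => yU.
- by move=> ->; rewrite eqxx.
- by have := UW x y; rewrite !inE xH yH xU yU xy => /(_ isT isT).
- by have := UW y x; rewrite !inE xH yH xU yU edge_sym xy => /(_ isT isT).
- by move=> [->]; rewrite eqxx.
Qed.

(** * Dominating supersets and component representatives *)

(** Take [K] maximal among the supersets of [H] with no larger chromatic number: an undominated
    vertex could still be added. *)
Lemma exists_dominating (G : sgraph) (H : {set G}) : H != set0 ->
  exists K : {set G},
    [/\ H \subset K, chi (induced K) <= chi (induced H) & dominating K].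
Proof.
move=> H0; pose P (K : {set G}) :=
  (H \subset K) && (chi (induced K) <= chi (induced H)).
have PH : P H by rewrite /P subxx leqnn.
have [K /maxsetP[/andP[HK chiK] K_max] _] := maxset_exists PH.
exists K; split=> // a aK; apply/exists_inP; apply: contraNT aK.
rewrite negb_exists_in => /forall_inP a_isolated.
have K0 : K != set0 by apply: subset_neq0 H0.
rewrite -(K_max (a |: K)) ?setU11 ?subsetUr // /P.
rewrite (subset_trans HK) ?subsetUr //.
exact: leq_trans (chi_setU1_isolated K0 a_isolated) chiK.
Qed.

(** Take one root per component: adjacent roots would share a component and so coincide.
    Independence is what brings in [alpha G]. *)
Lemma exists_independent_cover (G : sgraph) (H : {set G}) :
  exists T : {set G}, independent T /\ covers T H.
Proof.
have Hsym := edge_in_connect_sym H.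
exists [set x in H | root (edge_in H) x == x]; split=> [|x xH].
  apply/forall_inP=> x; rewrite inE => /andP[xH /eqP rx].
  apply/forall_inP=> y; rewrite inE => /andP[yH /eqP ry].
  apply/negP=> xy; have: connect (edge_in H) x y.
    by apply: connect1; rewrite /edge_in xH yH.
  move/(rootP Hsym); rewrite rx ry => exy.
  by rewrite exy edge_irr in xy.
exists (root (edge_in H) x); last exact: connect_root.
by rewrite inE (connect_edge_in_mem xH (connect_root _ x)) (root_root Hsym) eqxx.
Qed.

(** * Merging components *)

Lemma connect_crossing (T : finType) (e : rel T) (A : {set T}) (x y : T) :
  connect e x y -> x \in A -> y \notin A ->
  exists a b, [/\ a \in A, b \notin A & e a b].
Proof.
case/connectP=> p; elim: p x => [|z p IHp] x /=; first by move=> _ -> ->.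
case/andP=> xz zp y_last xA yA.
have [zA|zA] := boolP (z \in A); first exact: (IHp z).
by exists x, z.
Qed.

Lemma covers_merge (G : sgraph) (T H K : {set G}) (x w : G) :
  covers T H -> H \subset K -> x \in H -> w \in H ->
  ~~ connect (edge_in H) x w -> connect (edge_in K) x w ->
  {in K :\: H, forall z, connect (edge_in K) z x} ->
  exists2 T' : {set G}, #|T'| < #|T| & covers T' K.
Proof.
move=> covT HK xH wH xw xwK KH.
have [t tT xt] := covT x xH; have [s sT ws] := covT w wH.
have ts : t != s.
  apply: contraNneq xw => ts; apply: connect_trans xt _.
  by rewrite ts edge_in_connect_sym.
have xtK := connect_edge_inS HK xt; have wsK := connect_edge_inS HK ws.
exists (T :\ s); first by rewrite (cardsD1 s T) sT.
have tTs : t \in T :\ s by rewrite !inE ts.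
move=> z zK; have [zH|zH] := boolP (z \in H); last first.
  by exists t; rewrite // (connect_trans _ xtK) // KH // inE zH.
have [r rT zr] := covT z zH; have zrK := connect_edge_inS HK zr.
have [rs|rs] := eqVneq r s; last by exists r; rewrite // !inE rs.
(* The walk goes from [z] through [s], [w] and [x] to [t]. *)
exists t => //; rewrite rs in zrK; apply: connect_trans zrK _.
rewrite edge_in_connect_sym in wsK; apply: connect_trans wsK _.
by rewrite edge_in_connect_sym in xwK; apply: connect_trans xwK _.
Qed.

Lemma dominating_merge (G : sgraph) (H T : {set G}) :
  connected G -> H != set0 -> dominating H -> covers T H ->
  ~~ connected (induced H) ->
  exists K T' : {set G}, [/\ H \subset K, #|T'| < #|T|, covers T' K
    & chi (induced K) <= (chi (induced H)).+1].
Proof.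
move=> Gconn H0 domH covT nconn; have Hsym := edge_in_connect_sym H.
have [x [y [xH yH xy]]] : exists x y,
    [/\ x \in H, y \in H & ~~ connect (edge_in H) x y].
  apply: contrapT => conn; case/negP: nconn; apply: connected_induced.
  move=> x y xH yH; apply: contrapT => /negP xy; apply: conn.
  by exists x, y.
pose U := [set z | connect (edge_in H) x z].
have UH u : u \in U -> u \in H by rewrite inE; apply: connect_edge_in_mem.
have UW u w : u \in U -> w \in H -> edge u w -> w \in U.
  move=> uU wH uw; move: (UH u uU) (uU) => uH; rewrite !inE => xu.
  by apply: connect_trans xu (connect1 _); rewrite /edge_in uH wH.
(* An edge leaving the closed neighborhood [N] of the component [U] starts at a vertex outside [U]
   with a neighbor in [U], and ends at a vertex with no neighbor in [U]. *)
pose N := [set z | (z \in U) || [exists u in U, edge z u]].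
have xU : x \in U by rewrite inE connect0.
have yN : y \notin N.
  have yU : y \notin U by rewrite inE.
  rewrite inE negb_or yU; apply/exists_inP=> -[u uU]; rewrite edge_sym => uy.
  by rewrite (UW u) in yU.
have xN : x \in N by rewrite inE xU.
have [a [b [aN bN ab]]] :=
  connect_crossing (forallP (forallP Gconn x) y) xN yN.
have aU : a \notin U.
  apply: contraNN bN => aU; rewrite inE; apply/orP; right.
  by apply/exists_inP; exists a; rewrite // edge_sym.
move: aN; rewrite inE (negPf aU) => /exists_inP[u uU au].
move: bN; rewrite inE negb_or => /andP[bU /exists_inP bU'].
have aH : a \notin H.
  by apply: contraNN aU => aH; apply: (UW u) => //; rewrite edge_sym.
have uH := UH u uU; have xu : connect (edge_in H) x u by move: uU; rewrite inE.
have nxw w : w \notin U -> ~~ connect (edge_in H) x w by rewrite inE.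
(* If [a] also has a neighbor in [H] outside [U], then [a] alone joins two components; otherwise [b]
   lies outside [H], and domination gives it a neighbor in [H], necessarily outside [U]. *)
have [/exists_inP[w] | aW] := boolP [exists w in H :\: U, edge a w].
  rewrite !inE => /andP[xw wH] aw; exists (a |: H).
  have HK : H \subset a |: H by apply: subsetUr.
  have xuK := connect_edge_inS HK xu.
  have uaK : connect (edge_in (a |: H)) u a.
    by apply: connect1; rewrite /edge_in setU11 setU1r // edge_sym.
  have xaK := connect_trans xuK uaK.
  have [T' T'T covT'] : exists2 T' : {set G}, #|T'| < #|T| & covers T' (a |: H).
    apply: (covers_merge covT HK xH wH xw).
      apply: connect_trans xaK (connect1 _).
      by rewrite /edge_in setU11 setU1r.
    by move=> z /setDP[/setU1P[->|zH /negP//] _]; rewrite edge_in_connect_sym.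
  by exists T'; split=> //; apply: chi_setU1.
have bH : b \notin H.
  by apply: contraNN aW => bH; apply/exists_inP; exists b; rewrite // in_setD bU.
have [w wH bw] := domH b bH.
have wU : w \notin U by apply/negP=> wU; case: bU'; exists w.
pose K := a |: (b |: H); have HK : H \subset K by rewrite /K setUA subsetUr.
have aK : a \in K by rewrite !inE eqxx.
have bK : b \in K by rewrite !inE eqxx orbT.
have xaK : connect (edge_in K) x a.
  apply: connect_trans (connect_edge_inS HK xu) (connect1 _).
  by rewrite /edge_in aK (subsetP HK) // edge_sym.
have xbK : connect (edge_in K) x b.
  by apply: connect_trans xaK (connect1 _); rewrite /edge_in aK bK.
have [T' T'T covT'] : exists2 T' : {set G}, #|T'| < #|T| & covers T' K.
  apply: (covers_merge covT HK xH wH (nxw w wU)).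
    apply: connect_trans xbK (connect1 _).
    by rewrite /edge_in bK (subsetP HK).
  move=> z /setDP[/setU1P[->|/setU1P[->|zH /negP//]] _];
    by rewrite edge_in_connect_sym.
exists K, T'; split=> //; apply: (@chi_setU2 _ _ U) => //.
- move=> v z /setIP[_ vU] /setDP[zH zU]; apply: contraNN zU; exact: UW.
- by move=> z zW; apply: contraNN aW => az; apply/exists_inP; exists z.
- by move=> v /setIP[_ vU]; apply/negP=> bv; case: bU'; exists v.
Qed.

(** Each merge costs at most one color and at least one representative, and domination passes to
    supersets. *)
Lemma dominating_connected_extension (G : sgraph) (H T : {set G}) :
  connected G -> H != set0 -> dominating H -> covers T H ->
  exists K : {set G}, [/\ H \subset K, connected (induced K)
    & chi (induced K) < chi (induced H) + #|T|].
Proof.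
move=> Gconn; have [n] := ubnP #|T|; elim: n H T => // n IHn H T.
rewrite ltnS => Tn H0 domH covT.
have [Hconn|nconn] := boolP (connected (induced H)).
  (* One representative remains at the end; this makes the bound strict and yields the final
     [- 1]. *)
  exists H; split=> //; case/set0Pn: H0 => x /covT[t tT _].
  have: 0 < #|T| by apply/card_gt0P; exists t.
  lia.
have [K [T' [HK T'T covT' chiK]]] := dominating_merge Gconn H0 domH covT nconn.
have domK : dominating K.
  move=> a aK; have [|u uH au] := domH a.
    by apply: contraNN aK; apply: (subsetP HK).
  by exists u; first exact: (subsetP HK).
have [||L [KL Lconn chiL]] := IHn K T' _ _ domK covT'.
- exact: leq_trans T'T Tn.
- exact: subset_neq0 HK H0.
exists L; split=> //; first exact: subset_trans HK KL.
lia.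
Qed.

Lemma connected_extension (G : sgraph) (H : {set G}) :
  connected G -> H != set0 ->
  exists K : {set G}, [/\ H \subset K, connected (induced K)
    & chi (induced K) < chi (induced H) + alpha G].
Proof.
move=> Gconn H0; have [D [HD chiD domD]] := exists_dominating H0.
have D0 : D != set0 := subset_neq0 HD H0.
have [T [indT covT]] := exists_independent_cover D.
have [K [DK Kconn chiK]] := dominating_connected_extension Gconn D0 domD covT.
have: #|T| <= alpha G by apply: (@leq_bigmax_cond _ _ (fun S : {set G} => #|S|)).
exists K; split=> //; first exact: subset_trans HD DK.
lia.
Qed.

(** * Comparison of the two parameters *)

Lemma size_colorsS (G : sgraph) (C : eqType) (c : G -> C) (H K : {set G}) :
  H \subset K -> size (colors c H) <= size (colors c K).
Proof.
move=> /subsetP HK; apply: uniq_leq_size; first exact: undup_uniq.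
by move=> i; rewrite !mem_undup => /imageP[x xH ->]; rewrite image_f ?HK.
Qed.

Lemma phi_of_le_phihat_of (G : sgraph) (C : eqType) (c : G -> C) :
  connected G -> phi_of c <= phihat_of c + alpha G - 1.
Proof.
move=> Gconn; apply/bigmax_leqP=> H H0.
have [K [HK Kconn chiK]] := connected_extension Gconn H0.
have K0 : K != set0 := subset_neq0 HK H0.
have : size (colors c K) - chi (induced K) <= phihat_of c.
  apply: (@leq_bigmax_cond _ _
    (fun K : {set G} => size (colors c K) - chi (induced K))).
  by rewrite K0.
have := size_colorsS c HK.
lia.
Qed.

Theorem theorem6p1 (G : sgraph) (G_nonempty : 0 < #|G|)
    (G_connected : connected G) :
  phi G <= phihat G + alpha G - 1.
Proof.
rewrite /phihat /min_coloring.
(* A coloring [c] attaining [phihat G] is a candidate in the minimum defining [phi G]. *)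
case: ex_minnP => _ /asboolP[c c_proper <-] _.
apply: leq_trans (phi_of_le_phihat_of c G_connected).
rewrite /phi /min_coloring; case: ex_minnP => m _; apply.
by apply/asboolP; exists c.
Qed.
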